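(* If $T$ is a tree, then $L(T)$ and $Q(T)$ are both $(2,2)$-choosable.
   Context: Graphs are finite and simple. For a connected graph $G$: the line graph $L(G)$ has the edges of $G$ as its vertices, two of them being adjacent when they share a vertex of $G$; and $Q(G)$ is the graph obtained from $G$ by inserting a new vertex into each edge of $G$ (subdividing each edge once) and then joining by an edge each pair of new vertices that lie on adjacent edges of $G$. A total-weighting of $G=(V,E)$ is a mapping $f:V\cup E\to\mathbb{R}$. For $v\in V$ put $s(v)=f(v)+\sum_{e\in E(v)}f(e)$, where $E(v)$ is the set of edges incident with $v$. The total-weighting $f$ is proper if $s(u)\neq s(v)$ for any two adjacent vertices $u,v$. The graph $G$ is $(k,k')$-choosable if for every assignment $L$ of a set $L(v)$ of $k$ real numbers to each vertex $v$ and a set $L(e)$ of $k'$ real numbers to each edge $e$, there is a proper total-weighting $f$ with $f(z)\in L(z)$ for all $z\in V\cup E$. *)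

(* Defs.v *)
From HB Require Import structures.
From mathcomp Require Import all_boot all_order all_algebra.
From mathcomp Require Import finmap reals.
Set Implicit Arguments.
Unset Strict Implicit.
Unset Printing Implicit Defensive.
Import GRing.Theory.
Local Open Scope ring_scope.

Record sgraph := SGraph {
  vertex :> finType;
  adj : rel vertex;
  adj_sym : symmetric adj;
  adj_irrefl : irreflexive adj }.

Definition edge_set (G : sgraph) : {set {set G}} :=
  [set [set p.1; p.2] | p : G * G & adj p.1 p.2].

Definition edge (G : sgraph) := {A : {set G} | A \in edge_set G}.
HB.instance Definition _ (G : sgraph) := SubFinite.on (edge G).

(* Connectedness includes nonemptiness, so the null graph is not a tree. *)
Definition connected_graph (G : sgraph) : Prop :=
  (0 < #|G|)%N /\ forall x y : G, connect (@adj G) x y.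

(* The bound on the size excludes [ucycle]'s degenerate cycles: the empty one
   and the back-and-forth traversal of a single edge. *)
Definition acyclic_graph (G : sgraph) : Prop :=
  forall c : seq G, (2 < size c)%N -> ~ ucycle (@adj G) c.

Definition tree (G : sgraph) : Prop := connected_graph G /\ acyclic_graph G.

Definition line_adj (G : sgraph) : rel (edge G) :=
  fun A B => (A != B) && (val A :&: val B != set0).

Lemma line_adj_sym G : symmetric (@line_adj G).
Proof. by move=> A B; rewrite /line_adj eq_sym setIC. Qed.

Lemma line_adj_irrefl G : irreflexive (@line_adj G).
Proof. by move=> A; rewrite /line_adj eqxx. Qed.

Definition line_graph (G : sgraph) : sgraph :=
  SGraph (@line_adj_sym G) (@line_adj_irrefl G).

(* [inr A] is the vertex inserted into the edge [A]; the edges of [G] itself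
   disappear, being replaced by their two halves. *)
Definition q_adj (G : sgraph) : rel (G + edge G)%type :=
  fun z w => match z, w with
  | inl _, inl _ => false
  | inl x, inr A => x \in val A
  | inr A, inl x => x \in val A
  | inr A, inr B => line_adj A B
  end.

Lemma q_adj_sym G : symmetric (@q_adj G).
Proof. by move=> [x|A] [y|B] //=; apply: line_adj_sym. Qed.

Lemma q_adj_irrefl G : irreflexive (@q_adj G).
Proof. by move=> [x|A] //=; apply: line_adj_irrefl. Qed.

Definition q_graph (G : sgraph) : sgraph :=
  SGraph (@q_adj_sym G) (@q_adj_irrefl G).

Definition vertex_sum (R : realType) (G : sgraph) (f : G + edge G -> R)
    (v : G) : R :=
  f (inl v) + \sum_(A : edge G | v \in val A) f (inr A).

Definition proper_weighting (R : realType) (G : sgraph)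
    (f : G + edge G -> R) : Prop :=
  forall u v : G, adj u v -> vertex_sum f u <> vertex_sum f v.

Definition choosable (R : realType) (k k' : nat) (G : sgraph) : Prop :=
  forall L : G + edge G -> {fset R},
    (forall v : G, #|` L (inl v)| = k) ->
    (forall A : edge G, #|` L (inr A)| = k') ->
    exists f : G + edge G -> R,
      proper_weighting f /\ forall z, f z \in L z.

(* Main.v *)
Require Import Defs.
From mathcomp Require Import all_boot all_order all_algebra all_fingroup.
From mathcomp Require Import finmap reals ring zify.

(** Let [s] be the vector of vertex sums of a weighting [f] of a graph. Each
    vertex or edge [z] contributes [f z] times its incidence vector [dir z], so
    [f] is proper exactly when the product of the linear forms [s v - s u], over
    the adjacent pairs [u, v], does not vanish. By the Combinatorial
    Nullstellensatz for products of linear forms ([nullstellensatz]), such an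
    [f] can be found in any lists of two weights as soon as, for as many distinct
    elements [z] as there are adjacent pairs, the matrix with entries
    [dir z v - dir z u] has a nonzero permanent. As permanents are multilinear, a
    column may also be a difference [dir z - dir z'], provided that no element is
    used twice altogether ([per_specs]).

    A forest [T] is dismantled by removing vertices with at most one remaining
    neighbour. The elements of the line graph (or of Q(T)) at the vertex removed
    form a clique [y_0, ..., y_(n-1)], and at most one of them also lies in the
    clique of a vertex removed later: the edge to the remaining neighbour, which
    is taken to be [y_0]. For this clique choose the columns
    - [y_j], for [0 < j];
    - the edge [y_i y_j], for [0 < i < j] and [i + j <> n];
    - the difference of the edges [y_0 y_i] and [y_0 y_j], for [0 < i < j] and
      [i + j = n].
    There is one column for each pair of members, and none involves [y_0], since
    it cancels in the differences. So the columns chosen for one clique vanish on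
    the pairs of all later cliques, the matrix is block triangular and the
    permanent is the product of those of the cliques ([per_cat]).

    It remains to see that the permanent of one clique is not zero
    ([per_block_neq0]). Up to the choice of additive constants in the factors, it
    is obtained by applying the product of the differences [E_j - E_i] of unit
    shifts to the product of the linear forms given by the columns. The
    Vandermonde identity turns this into the signed sum, over the permutations
    [s] of the positions, of the values
    [prod_j s_j * prod_(i+j=n) (s_i - s_j) * prod_(i+j<>n) (s_i + s_j - n)], with
    [0 < i < j], where the constants [- n] have been chosen to make most terms
    vanish: a term is nonzero only if [s_0 = 0] and [s_(n-i) = n - s_i]
    ([mirror_of_nonzero]). Then, multiplied by [prod_(i<j) (s_j - s_i)], which
    has the sign of [s], it is a product of squares up to a sign that does not
    depend on [s] ([prod_block_form]). So nothing cancels, and the identity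
    permutation contributes a nonzero term. *)

Set Implicit Arguments.
Unset Strict Implicit.
Unset Printing Implicit Defensive.
Import Order.TTheory GRing.Theory Num.Theory.
Local Open Scope ring_scope.

(** * Permanents of pairings *)

(** The ways to single out one entry of a sequence, each with what is left. *)
Fixpoint picks (T : Type) (s : seq T) : seq (T * seq T) :=
  if s is x :: s' then (x, s') :: [seq (p.1, x :: p.2) | p <- picks s']
  else [::].

Lemma picks_cat (T : Type) (s1 s2 : seq T) :
  picks (s1 ++ s2) = [seq (p.1, p.2 ++ s2) | p <- picks s1]
                     ++ [seq (p.1, s1 ++ p.2) | p <- picks s2].
Proof.
elim: s1 => [|x s1 IHs] /=; first by rewrite -[LHS]map_id; apply: eq_map => -[].
by rewrite IHs map_cat -!map_comp.
Qed.

Lemma mem_picks (T : eqType) (s : seq T) p : p \in picks s -> p.1 \in s.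
Proof.
elim: s p => //= x s IHs p; rewrite inE => /predU1P[-> | /mapP[q /IHs qs ->]].
  exact: mem_head.
by rewrite /= qs orbT.
Qed.

Lemma size_picks (T : eqType) (s : seq T) p :
  p \in picks s -> size s = (size p.2).+1.
Proof.
by elim: s p => //= x s IHs p; rewrite inE => /predU1P[-> | /mapP[q /IHs -> ->]].
Qed.

Section Permanent.
Variables (R : comNzRingType) (W : zmodType) (B : W -> W -> R).

(** The permanent of the matrix of values [B d l], expanded along the first
    vector of [ds]. Its value is meaningful only when [ds] and [ls] have the same
    length. *)
Fixpoint per (ds ls : seq W) : R :=
  if ds is d :: ds' then \sum_(p <- picks ls) B d p.1 * per ds' p.2 else 1.

(** Both expansions, by the first [d] and by the first [l], lead to the same
    double sum, so an induction on [ds] exchanges them. *)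
Lemma per_expand_row l ds ls : size ds = (size ls).+1 ->
  per ds (l :: ls) = \sum_(p <- picks ds) B p.1 l * per p.2 ls.
Proof.
elim: ds ls => // d ds IHds ls [szE] /=.
rewrite !big_cons !big_map /=; congr (_ + _).
transitivity (\sum_(q <- picks ls) \sum_(p <- picks ds)
               B d q.1 * (B p.1 l * per p.2 q.2)).
  rewrite big_seq [RHS]big_seq; apply: eq_bigr => q qls.
  rewrite IHds ?mulr_sumr //.
  by rewrite szE (size_picks qls).
rewrite exchange_big; apply: eq_bigr => p _ /=.
by rewrite mulr_sumr; apply: eq_bigr => q _; rewrite mulrCA.
Qed.

Hypothesis BC : forall d l, B d l = B l d.

Lemma per_sym ds ls : size ds = size ls -> per ds ls = per ls ds.
Proof.
elim: ls ds => [|l ls IHls] [|d ds] // [szE].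
rewrite per_expand_row; last by rewrite /= szE.
transitivity (\sum_(p <- picks (d :: ds)) B l p.1 * per ls p.2); last by [].
apply: eq_big_seq => p pds.
rewrite BC IHls //; apply: succn_inj.
by rewrite -(size_picks pds) /= szE.
Qed.

(** Block triangular matrices: the vectors of [ds1] can only be matched with
    those of [ls1], and as many, so they exhaust them. *)
Lemma per_cat ds1 ds2 ls1 ls2 : size ds1 = size ls1 ->
    (forall d l, d \in ds1 -> l \in ls2 -> B d l = 0) ->
  per (ds1 ++ ds2) (ls1 ++ ls2) = per ds1 ls1 * per ds2 ls2.
Proof.
elim: ds1 ls1 => [|d ds1 IHds] ls1 szE B0 /=.
  by case: ls1 szE => //= _; rewrite mul1r.
rewrite picks_cat big_cat !big_map /= [X in _ + X]big_seq [X in _ + X]big1 => [|p].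
  rewrite addr0 mulr_suml; apply: eq_big_seq => p pls /=.
  rewrite -mulrA IHds // => [|d' l d'ds lls].
    by apply: succn_inj; rewrite -(size_picks pls).
  by rewrite B0 // in_cons d'ds orbT.
by move/mem_picks=> pls; rewrite B0 ?mul0r // mem_head.
Qed.

Hypothesis BDl : forall d d' l, B (d + d') l = B d l + B d' l.

Lemma B0l l : B 0 l = 0.
Proof. by apply: (addrI (B 0 l)); rewrite -BDl !addr0. Qed.

Lemma BBl d d' l : B (d - d') l = B d l - B d' l.
Proof. by apply: (addIr (B d' l)); rewrite -BDl !subrK. Qed.

(** The permanent is linear in each of its columns. *)
Lemma per_subr ds1 d d' ds2 ls :
  per (ds1 ++ (d - d') :: ds2) ls
  = per (ds1 ++ d :: ds2) ls - per (ds1 ++ d' :: ds2) ls.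
Proof.
elim: ds1 ls => [|d1 ds1 IHds] ls /=; rewrite -sumrB; apply: eq_bigr => p _.
  by rewrite BBl mulrBl.
by rewrite IHds mulrBr.
Qed.

Lemma per_scale (Z : Type) (c : Z -> R) (w w' : Z -> W) zs ls :
    (forall z l, B (w z) l = c z * B (w' z) l) ->
  per (map w zs) ls = (\prod_(z <- zs) c z) * per (map w' zs) ls.
Proof.
move=> Bw; elim: zs ls => [|z zs IHzs] ls /=; first by rewrite big_nil mulr1.
rewrite big_cons mulr_sumr; apply: eq_bigr => p _.
by rewrite Bw IHzs mulrACA.
Qed.

(** * Iterated differences and the Combinatorial Nullstellensatz *)

(** The value at 0 of [phi] after taking, for each step [(u, w)], the difference
    of its translates by [u] and by [w]. *)
Fixpoint iter_diff (steps : seq (W * W)) (phi : W -> R) : R :=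
  if steps is (u, w) :: r then
    iter_diff r (fun t => phi (u + t)) - iter_diff r (fun t => phi (w + t))
  else phi 0.

Lemma eq_iter_diff r phi phi' : phi =1 phi' -> iter_diff r phi = iter_diff r phi'.
Proof.
elim: r phi phi' => [|[u w] r IHr] phi phi' eq_phi /=; first exact: eq_phi.
by congr (_ - _); apply: IHr => t; apply: eq_phi.
Qed.

Lemma iter_diffD r phi phi' :
  iter_diff r (fun t => phi t + phi' t) = iter_diff r phi + iter_diff r phi'.
Proof.
elim: r phi phi' => [|[u w] r IHr] phi phi' //=.
by rewrite !IHr opprD addrACA.
Qed.

Lemma iter_diffZ r c phi :
  iter_diff r (fun t => c * phi t) = c * iter_diff r phi.
Proof.
by elim: r phi => [|[u w] r IHr] phi //=; rewrite !IHr mulrBr.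
Qed.

Lemma iter_diffB r phi phi' :
  iter_diff r (fun t => phi t - phi' t) = iter_diff r phi - iter_diff r phi'.
Proof.
rewrite -[X in _ = _ + X]mulN1r -iter_diffZ -iter_diffD.
by apply: eq_iter_diff => t; rewrite mulN1r.
Qed.

(** A difference along [u - w] lowers the degree of a product of affine forms by
    one, so that after as many steps as there are factors only the top degree
    part survives. This makes the constants of the forms, and the points at which
    the differences are taken, irrelevant. *)
Lemma iter_diff_prod (steps : seq (W * W)) (forms : seq (W * R)) :
    size steps = size forms ->
  iter_diff steps (fun t => \prod_(f <- forms) (f.2 + B t f.1))
  = per [seq s.1 - s.2 | s <- steps] [seq f.1 | f <- forms].
Proof.
elim: steps forms => [|[u w] r IHr] forms szE.
  by case: forms szE => //= _; rewrite big_nil.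
move: szE => /= szE.
pose ev (f : W * R) t := f.2 + B t f.1.
pose sh v (f : W * R) := (f.1, f.2 + B v f.1).
have evD v t f : ev f (v + t) = ev (sh v f) t by rewrite /ev BDl addrA.
rewrite -iter_diffB.
(* Telescoping: the factors before the one that is differentiated, kept in
   [pre], have been translated by [u], and those after it by [w]. *)
suff gen pre fs : size (pre ++ fs) = (size r).+1 ->
    iter_diff r (fun t => (\prod_(f <- pre) ev f t) *
       (\prod_(f <- fs) ev f (u + t) - \prod_(f <- fs) ev f (w + t)))
    = \sum_(p <- picks [seq f.1 | f <- fs])
        B (u - w) p.1 * per [seq s.1 - s.2 | s <- r] ([seq f.1 | f <- pre] ++ p.2).
  rewrite -[RHS](gen [::]) //; apply: eq_iter_diff => t.
  by rewrite big_nil mul1r.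
elim: fs pre => [|f fs IHfs] pre szP.
  rewrite /= big_nil (@eq_iter_diff _ _ (fun t => 0 * 0)) => [|t].
    by rewrite iter_diffZ mul0r.
  by rewrite !big_nil subrr mulr0 mul0r.
rewrite /= big_cons big_map /=.
have split_diff t : (\prod_(f <- pre) ev f t) *
       (\prod_(f <- f :: fs) ev f (u + t) - \prod_(f <- f :: fs) ev f (w + t))
   = B (u - w) f.1 * (\prod_(g <- pre ++ map (sh w) fs) ev g t)
     + (\prod_(g <- rcons pre (sh u f)) ev g t) *
       (\prod_(f <- fs) ev f (u + t) - \prod_(f <- fs) ev f (w + t)).
  rewrite !big_cons big_cat big_map big_rcons /=.
  under [X in B _ _ * (_ * X)]eq_bigr do rewrite -evD.
  rewrite -evD.
  have -> : B (u - w) f.1 = ev f (u + t) - ev f (w + t).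
    by rewrite BBl /ev !BDl !addrA [f.2 + B u _]addrC [f.2 + B w _]addrC; ring.
  move: (\prod_(g <- pre) _) (\prod_(g <- fs) _) (\prod_(g <- fs) _) => a b c.
  by ring.
rewrite (eq_iter_diff _ split_diff) iter_diffD iter_diffZ; congr (_ * _ + _).
  rewrite IHr ?map_cat -?map_comp //.
  by move: szP; rewrite !size_cat size_map /= addnS => -[].
rewrite IHfs; last by rewrite -szP cat_rcons !size_cat.
by apply: eq_bigr => p _; rewrite map_rcons cat_rcons.
Qed.

End Permanent.

Section Nullstellensatz.
Variables (R : idomainType) (W : lmodType R) (B : W -> W -> R).
Hypothesis BDl : forall d d' l, B (d + d') l = B d l + B d' l.
Hypothesis BZl : forall c d l, B (c *: d) l = c * B d l.

(** The iterated difference only evaluates [phi] at points of the grid. *)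
Lemma iter_diff_eq0 (Z : eqType) (dir : Z -> W) (alpha beta : Z -> R) zs
    (phi : W -> R) :
    uniq zs ->
    (forall c : Z -> R, (forall z, c z = alpha z \/ c z = beta z) ->
       phi (\sum_(z <- zs) c z *: dir z) = 0) ->
  iter_diff [seq (beta z *: dir z, alpha z *: dir z) | z <- zs] phi = 0.
Proof.
elim: zs phi => [|z zs IHzs] phi /=.
  by move=> _ /(_ alpha); rewrite big_nil; apply; left.
case/andP=> zNzs uniq_zs phi0; suff tail0 x : x = alpha z \/ x = beta z ->
    iter_diff [seq (beta z *: dir z, alpha z *: dir z) | z <- zs]
      (fun t => phi (x *: dir z + t)) = 0.
  by rewrite !tail0 ?subrr //; [left | right].
move=> x_ab; apply: IHzs => // c c_ab.
pose c' y := if y == z then x else c y.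
rewrite -(phi0 c') => [|y]; last by rewrite /c'; case: eqP => // ->.
rewrite big_cons /c' eqxx; congr (phi (_ + _)); apply: eq_big_seq => y yzs.
by rewrite ifN //; apply: contraNneq zNzs => <-.
Qed.

(** If every choice made some form vanish, the iterated difference of the product
    of the forms would be zero, while by [iter_diff_prod] it is the permanent up
    to the nonzero factor [prod (beta z - alpha z)]. *)
Lemma nullstellensatz (Z : finType) (dir : Z -> W) (alpha beta : Z -> R) zs ls :
    (forall z, alpha z != beta z) -> uniq zs -> size zs = size ls ->
    per B (map dir zs) ls != 0 ->
  exists2 f : Z -> R, (forall z, f z = alpha z \/ f z = beta z)
    & forall l, l \in ls -> B (\sum_z f z *: dir z) l != 0.
Proof.
move=> ab_neq uniq_zs szE per_neq0.
pose fval (s : {ffun Z -> bool}) z := if s z then beta z else alpha z.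
have [/existsP[s /allP s_ok] | /existsPn no_s] :=
  boolP [exists s, all (fun l => B (\sum_z fval s z *: dir z) l != 0) ls].
  exists (fval s) => // z.
  by rewrite /fval; case: (s z); [right | left].
case/negP: per_neq0.
(* Elements outside [zs] keep the value [alpha], which only contributes constants
   to the forms. *)
pose base l := B (\sum_(z | z \notin zs) alpha z *: dir z) l.
pose steps := [seq (beta z *: dir z, alpha z *: dir z) | z <- zs].
have diff0 : iter_diff steps (fun t => \prod_(f <- [seq (l, base l) | l <- ls])
                                         (f.2 + B t f.1)) = 0.
  apply: iter_diff_eq0 => // c c_ab; rewrite big_map /=.
  pose s := [ffun z => (z \in zs) && (c z == beta z)].
  have /allPn[l lls /negPn/eqP Bl0] := no_s s.
  apply/eqP; rewrite prodf_seq_eq0; apply/hasP; exists l => //=.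
  rewrite /base -BDl -[X in _ == X]Bl0; apply/eqP; congr (B _ l).
  rewrite [RHS](bigID (mem zs)) /= addrC; congr (_ + _).
    by apply: eq_bigr => z zNzs; rewrite /fval ffunE (negPf zNzs).
  rewrite big_uniq //=; apply: eq_bigr => z zzs; rewrite /fval ffunE zzs /=.
  by case: eqP => [-> // |]; case: (c_ab z) => ->.
move: diff0; rewrite iter_diff_prod ?size_map // -!map_comp map_id.
rewrite (@per_scale _ _ _ Z (fun z => beta z - alpha z) _ dir) => [|z l]; last first.
  by rewrite /= -scalerBl BZl.
move/eqP; rewrite mulf_eq0 => /orP[] //.
rewrite prodf_seq_eq0 => /hasP[z _ /=].
by rewrite subr_eq0 eq_sym (negPf (ab_neq z)).
Qed.

(** A pair [(z, oz)] specifies the column [dir z], or [dir z - dir z'] when [oz]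
    is [Some z']. *)
Definition spec_vars (Z : Type) (s : Z * option Z) : seq Z :=
  s.1 :: oapp (fun z => [:: z]) [::] s.2.

Definition spec_vec (Z : Type) (dir : Z -> W) (s : Z * option Z) : W :=
  if s.2 is Some z then dir s.1 - dir z else dir s.1.

(** By multilinearity one of the two terms of each difference can be kept without
    making the permanent vanish. *)
Lemma per_specs (Z : eqType) (dir : Z -> W) (specs : seq (Z * option Z)) ls :
    per B (map (spec_vec dir) specs) ls != 0 ->
  exists zs, [/\ size zs = size specs, subseq zs (flatten (map (@spec_vars Z) specs))
    & per B (map dir zs) ls != 0].
Proof.
suff gen pre : per B (pre ++ map (spec_vec dir) specs) ls != 0 ->
  exists zs, [/\ size zs = size specs, subseq zs (flatten (map (@spec_vars Z) specs))
    & per B (pre ++ map dir zs) ls != 0] by apply: (gen [::]).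
elim: specs pre => [|[z oz] specs IHs] pre nz0; first by exists [::].
suff choose y : y \in spec_vars (z, oz) ->
    per B (pre ++ dir y :: map (spec_vec dir) specs) ls != 0 ->
  exists zs, [/\ size zs = (size specs).+1,
      subseq zs (spec_vars (z, oz) ++ flatten (map (@spec_vars Z) specs))
    & per B (pre ++ map dir zs) ls != 0].
  case: oz choose nz0 => [z'|] choose; rewrite /= {1}/spec_vec /= => nz0.
    have [y0 | ynz] := eqVneq (per B (pre ++ dir z :: map (spec_vec dir) specs) ls) 0.
      apply: (choose z'); first by rewrite !inE eqxx orbT.
      by move: nz0; rewrite per_subr // y0 sub0r oppr_eq0.
    by apply: (choose z); rewrite ?mem_head.
  by apply: (choose z); rewrite ?mem_head.
move=> y_in; rewrite -cat_rcons => /IHs[zs [sz sub nz]].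
exists (y :: zs); split; first by rewrite /= sz.
  by apply: (@cat_subseq _ [:: y]); rewrite ?sub1seq.
by rewrite /= -cat_rcons.
Qed.
End Nullstellensatz.

(** * The Vandermonde identity for shift operators *)

Definition pairs (n : nat) : seq (nat * nat) :=
  [seq p <- [seq (i, j) | i <- iota 0 n, j <- iota 0 n] | (p.1 < p.2)%N].

Lemma mem_pairs n i j : ((i, j) \in pairs n) = (i < j < n)%N.
Proof.
rewrite mem_filter /=; case: ltnP => //= lt_ij.
apply/allpairsP/idP => [[[i' j'] /= [_ + [_ ->]]] | lt_jn].
  by rewrite mem_iota.
by exists (i, j); rewrite /= !mem_iota /= (ltn_trans lt_ij).
Qed.

Lemma uniq_pairs n : uniq (pairs n).
Proof. by apply/filter_uniq/allpairs_uniq; rewrite ?iota_uniq // => -[? ?] []. Qed.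

Lemma prod_pairs (R : comPzRingType) n (F : nat -> nat -> R) :
  \prod_(p <- pairs n) F p.1 p.2 = \prod_(i < n) \prod_(j < n | (i < j)%N) F i j.
Proof.
rewrite big_filter big_mkcond big_allpairs /= -{1}[n]subn0 big_mkord.
apply: eq_bigr => i _; rewrite [RHS]big_mkcond /=.
by rewrite -{1}[n]subn0 big_mkord.
Qed.

Lemma ltn_digits N (v : nat -> nat) n : (forall i, v i < N)%N ->
  (\sum_(i < n) v i * N ^ i < N ^ n)%N.
Proof.
move=> vN; elim: n v vN => [|n IHn] v vN; first by rewrite big_ord0.
rewrite big_ord_recl expn0 muln1.
under eq_bigr do rewrite lift0 expnSr mulnA.
rewrite -big_distrl /= expnSr.
apply: leq_trans (leq_mul (IHn _ (fun i => vN i.+1)) (leqnn N)).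
by rewrite mulSn ltn_add2r vN.
Qed.

Lemma digitK N (v : nat -> nat) n i : (forall i, v i < N)%N -> (i < n)%N ->
  ((\sum_(j < n) v j * N ^ j) %/ N ^ i %% N)%N = v i.
Proof.
elim: n v i => // n IHn v i vN lt_in.
have N_gt0 : (0 < N)%N by apply: leq_ltn_trans (vN 0%N).
rewrite big_ord_recl expn0 muln1.
under eq_bigr do rewrite lift0 expnSr mulnA.
rewrite -big_distrl /=; case: i lt_in => [|i] lt_in.
  by rewrite divn1 addnC modnMDl modn_small.
rewrite expnS divnMA addnC divnMDl // (divn_small (vN 0%N)) addn0.
exact: (IHn (fun i => v i.+1)).
Qed.

Definition perm_val n (s : 'S_n) (j : nat) : nat :=
  if insub j is Some i then s i else 0.

Lemma perm_valE n (s : 'S_n) (i : 'I_n) : perm_val s i = s i.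
Proof. by rewrite /perm_val valK. Qed.

Section ShiftVandermonde.
Variables (R : comNzRingType) (W : zmodType) (n : nat) (e : nat -> W).

(** The product of the differences [E_j - E_i] of the translations by [e j] and
    [e i] is a Vandermonde determinant, whose expansion gives the right-hand
    side. To work in a commutative ring, the operator [E_i] is represented by the
    univariate monomial ['X^(N ^ i)]: in base [N] the exponent of a product of at
    most [N - 1] such monomials shows how often each of them occurs. *)
Lemma iter_diff_Vandermonde (phi : W -> R) :
  iter_diff [seq (e p.2, e p.1) | p <- pairs n] phi
  = \sum_(s : 'S_n) (-1) ^+ s * phi (\sum_(i < n) e i *+ s i).
Proof.
pose N := (size (pairs n) + n).+1.
pose dec m := \sum_(i < n) e i *+ (m %/ N ^ i %% N).
(* The linear functional that sends a monomial of degree less than [N ^ n] to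
   the value of [phi] at the point encoded by the exponent. *)
pose psi (p : {poly R}) := \sum_(m < N ^ n) p`_m * phi (dec m).
have psiB p q : psi (p - q) = psi p - psi q.
  by rewrite -sumrB; apply: eq_bigr => m _; rewrite coefB mulrBl.
have psiX (v : nat -> nat) : (forall i, v i < N)%N ->
    psi 'X^(\sum_(i < n) v i * N ^ i) = phi (\sum_(i < n) e i *+ v i).
  move=> vN; rewrite /psi (bigD1 (Ordinal (ltn_digits n vN))) //= coefXn eqxx mul1r.
  rewrite [X in _ + X]big1 ?addr0 => [|m]; last first.
    by rewrite coefXn -val_eqE => /negPf /= ->; rewrite mul0r.
  by congr phi; apply: eq_bigr => i _; rewrite digitK.
have psi_diff Q (v : nat -> nat) : (forall p, p \in Q -> p.1 < n /\ p.2 < n)%N ->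
    (forall i, v i + size Q < N)%N ->
    iter_diff [seq (e p.2, e p.1) | p <- Q] (fun t => phi (\sum_(i < n) e i *+ v i + t))
    = psi ('X^(\sum_(i < n) v i * N ^ i) *
           \prod_(p <- Q) ('X^(N ^ p.2) - 'X^(N ^ p.1))).
  elim: Q v => [|[i j] Q IHQ] v Qn vN /=.
    by rewrite big_nil mulr1 addr0 psiX // => i; rewrite -[v i]addn0.
  have [/= lt_in lt_jn] := Qn (i, j) (mem_head _ _).
  have step k : (k < n)%N ->
      iter_diff [seq (e p.2, e p.1) | p <- Q]
        (fun t => phi (\sum_(i < n) e i *+ v i + (e k + t)))
      = psi ('X^(\sum_(i < n) v i * N ^ i) * 'X^(N ^ k) *
             \prod_(p <- Q) ('X^(N ^ p.2) - 'X^(N ^ p.1))).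
    move=> lt_kn; pose v' i := (v i + (i == k))%N.
    have sumv' (T : nmodType) (g : nat -> T) :
        \sum_(i < n) g i *+ v' i = \sum_(i < n) g i *+ v i + g k.
      transitivity (\sum_(i < n) (g i *+ v i + g i *+ (i == k :> nat))).
        by apply: eq_bigr => l _; rewrite mulrnDr.
      rewrite big_split /= [X in _ + X](bigD1 (Ordinal lt_kn)) //= eqxx mulr1n.
      by rewrite [X in _ + (_ + X)]big1 ?addr0 // => l; rewrite -val_eqE => /negPf /= ->.
    have -> : 'X^(\sum_(i < n) v i * N ^ i) * 'X^(N ^ k)
       = 'X^(\sum_(i < n) v' i * N ^ i) :> {poly R}.
      rewrite -exprD; congr ('X^_).
      under [RHS]eq_bigr do rewrite mulnDl.
      rewrite big_split /=; congr (_ + _)%N.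
      rewrite (bigD1 (Ordinal lt_kn)) //= eqxx mul1n big1 ?addn0 // => l.
      by rewrite -val_eqE => /negPf /= ->.
    rewrite -IHQ => [|p pQ|l]; last 2 first.
    - by apply: Qn; rewrite inE pQ orbT.
    - rewrite /v'; apply: leq_ltn_trans (vN l).
      by rewrite -addnA leq_add2l /= addnC -add1n addnC leq_add2r leq_b1.
    by apply: eq_iter_diff => t; rewrite sumv' addrA.
  rewrite !step // -psiB big_cons; congr psi.
  by rewrite [in RHS]mulrA mulrBr mulrBl.
transitivity (psi (\prod_(p <- pairs n) ('X^(N ^ p.2) - 'X^(N ^ p.1)))).
  have := psi_diff (pairs n) (fun=> 0%N).
  rewrite [X in 'X^X * _]big1 // expr0 mul1r => <- => [|[i j]|i].
  - apply: eq_iter_diff => t; congr phi.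
    by rewrite big1 ?add0r // => i _; rewrite mulr0n.
  - by rewrite mem_pairs => /andP[lt_ij lt_jn] /=; rewrite (ltn_trans lt_ij).
  - by rewrite add0n ltnS leq_addr.
rewrite (prod_pairs n (fun i j => 'X^(N ^ j) - 'X^(N ^ i))).
pose a : 'rV[{poly R}]_n := \row_i 'X^(N ^ i).
have := det_Vandermonde a.
under eq_bigr do under eq_bigr do rewrite !mxE.
move=> <-; rewrite -det_tr.
have psi0 : psi 0 = 0 by rewrite -(subrr 0) psiB subrr.
have psiN p : psi (- p) = - psi p by rewrite -sub0r psiB psi0 sub0r.
have psiD p q : psi (p + q) = psi p + psi q.
  by rewrite -{1}[q]opprK psiB psiN opprK.
rewrite /determinant (big_morph psi psiD psi0); apply: eq_bigr => s _.
have psi_sign p : psi ((-1) ^+ s * p) = (-1) ^+ s * psi p.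
  by case: (odd_perm s); rewrite ?expr1 ?expr0 ?mulN1r ?mul1r // psiN.
rewrite psi_sign; congr (_ * _).
under [in RHS]eq_bigr do rewrite -perm_valE.
rewrite -psiX => [|i]; last first.
  rewrite /perm_val; case: insub => [i'|//]; apply: ltn_trans (ltn_ord _) _.
  by rewrite ltnS leq_addl.
congr psi; rewrite expr_sum; apply: eq_bigr => i _.
by rewrite !mxE -exprM perm_valE mulnC.
Qed.
End ShiftVandermonde.

(** * The permanent of a clique *)

(** The values of [sg] at nonzero positions are [1, ..., n-1]. If [sg i + sg w = n]
    with [w <> i], then [w] must be [n - i]. So only [i] with [sg i + sg i = n]
    could fail to be matched with [n - i]. But then [i = n - i]: otherwise [n - i]
    is matched with [i], and [sg (n - i) = n - sg i = sg i]. *)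
Lemma mirror_of_nonzero n (sg : nat -> nat) :
    (forall j, j < n -> sg j < n)%N ->
    (forall i j, i < n -> j < n -> sg i = sg j -> i = j)%N ->
    (forall m, m < n -> exists2 j, j < n & sg j = m)%N ->
    (forall j, 0 < j < n -> sg j != 0)%N ->
    (forall i j, 0 < i < j -> j < n -> i + j != n -> sg i + sg j != n)%N ->
  (0 < n -> sg 0 = 0)%N /\ (forall i, 0 < i < n -> sg (n - i) = n - sg i)%N.
Proof.
move=> sgn sgI sgS sg1 sg2.
have sg0 : (0 < n -> sg 0 = 0)%N.
  case/sgS=> -[|j] // lt_jn /eqP; rewrite (negPf (sg1 _ _)) //.
split=> // i /andP[i_gt0 lt_in].
have n_gt0 : (0 < n)%N by apply: leq_trans lt_in.
have partner l : (0 < l < n)%N ->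
    exists w, [/\ (0 < w < n)%N, sg w = (n - sg l)%N & w = l \/ (w + l = n)%N].
  move=> ln; have lt_ln : (l < n)%N by lia.
  have sgl_gt0 : (0 < sg l)%N by rewrite lt0n sg1.
  have sgl_lt := sgn l lt_ln.
  have [|w lt_wn sgw] := sgS (n - sg l)%N; first by lia.
  have w_gt0 : (0 < w)%N by case: w sgw {lt_wn} => //; rewrite sg0 //; lia.
  exists w; split=> //; first by rewrite w_gt0.
  have [| wNl] := eqVneq w l; [by left | right].
  apply/eqP/contraT => wl_neq.
  have [lt_wl | le_lw] := ltnP w l.
    by have := sg2 w l; rewrite w_gt0 lt_wl lt_ln wl_neq => /(_ isT isT isT); lia.
  have lt_lw : (l < w)%N by lia.
  by have := sg2 l w; rewrite addnC wl_neq lt_lw lt_wn; lia.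
have [|w [w_n sgw [wi | wi]]] := partner i; first by lia.
  have [|w2 [w2_n sgw2 w2E]] := partner (n - i)%N; first by lia.
  have sgiE : (sg i + sg i = n)%N by have := sgn i lt_in; subst w; lia.
  case: w2E => w2E; last first.
    have w2i : w2 = i by lia. subst w2.
    have := sgn (n - i)%N ltac:(lia); lia.
  have ni : (n - i = i)%N by apply: sgI => //; [lia | subst w2; have := sgn (n - i)%N ltac:(lia); lia].
  by rewrite ni; lia.
by rewrite -sgw; congr sg; lia.
Qed.

Section Block.
Variables (R : realDomainType) (n : nat).

(** The values at [x] of the affine forms that go with the columns of a clique;
    the constant [- n] is what singles out the permutations that satisfy
    [x (n - i) = n - x i]. *)
Definition block_form (x : nat -> R) (p : nat * nat) : R :=
  if p.1 == 0%N then x p.2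
  else if (p.1 + p.2 == n)%N then x p.1 - x p.2 else x p.1 + x p.2 - n%:R.

Definition pair_sign (p : nat * nat) : R :=
  if (0 < p.1)%N && (p.1 + p.2 <= n)%N then -1 else 1.

Definition pair_square (x : nat -> R) (p : nat * nat) : R :=
  if p.1 == 0%N then x p.2 ^+ 2
  else if (p.1 + p.2 == n)%N then (x p.1 - x p.2) ^+ 2
  else if (p.1 + p.2 < n)%N then ((x p.1 + x p.2 - n%:R) * (x p.2 - x p.1)) ^+ 2
  else 1.

(** With [b i = x i * (x i - n)] one has [b (n - i) = b i], and the factor of a
    pair with [0 < i] and [i + j <> n] is [b j - b i]. The pairs [(i, j)] and
    [(n - j, n - i)] have opposite factors, so together they give minus a
    square; this is counted at the one with [i + j < n]. *)
Lemma prod_block_form (x : nat -> R) : x 0%N = 0 ->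
    (forall i, (0 < i < n)%N -> x (n - i)%N = n%:R - x i) ->
  \prod_(p <- pairs n) ((x p.2 - x p.1) * block_form x p)
  = \prod_(p <- pairs n) (pair_sign p * pair_square x p).
Proof.
move=> x0 xn.
pose big (p : nat * nat) := (0 < p.1)%N && (n < p.1 + p.2)%N.
pose small (p : nat * nat) := (0 < p.1)%N && (p.1 + p.2 < n)%N.
pose mir (p : nat * nat) := (n - p.2, n - p.1)%N.
pose F p := (x p.2 - x p.1) * block_form x p.
have mir_big : \prod_(p <- pairs n | big p) F p = \prod_(p <- pairs n | small p) F (mir p).
  rewrite -big_filter -[RHS]big_filter -(big_map mir xpredT F).
  apply: perm_big; apply: uniq_perm; first exact/filter_uniq/uniq_pairs.
    rewrite map_inj_in_uniq; first exact/filter_uniq/uniq_pairs.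
    move=> [i j] [i' j'].
    rewrite mem_filter mem_pairs /small /= => ij.
    rewrite mem_filter mem_pairs /= => ij' [].
    by move=> *; congr (_, _); lia.
  move=> [i j]; rewrite mem_filter mem_pairs /big /=; apply/idP/mapP => [ij|].
    exists (mir (i, j)); last by rewrite /mir /=; congr (_, _); lia.
    by rewrite mem_filter mem_pairs /small /=; lia.
  case=> -[i' j']; rewrite mem_filter mem_pairs /small /mir /= => ij [-> ->]; lia.
rewrite (bigID big) /= -/(F _) mir_big [in X in X * _]big_mkcond [RHS](bigID big) /=.
rewrite [X in _ = X * _]big1_seq ?mul1r => [|[i j]]; last first.
  rewrite mem_pairs /big /pair_sign /pair_square /= => ij.
  by do ![case: ifP => [|_]; first by lia]; rewrite mulr1.
rewrite [X in X * _ = _](bigID big) /= big1 ?mul1r => [|[i j]]; last first.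
  by rewrite /big /small /=; case: ifP => //; lia.
rewrite -big_split /= [LHS]big_seq_cond [RHS]big_seq_cond.
apply: eq_bigr => -[i j]; rewrite mem_pairs /big /small => /= ij.
rewrite /F /block_form /pair_sign /pair_square /mir /=.
have [-> | i_gt0] := posnP i; first by rewrite x0 /=; ring.
rewrite ?i_gt0; case: (ltngtP (i + j)%N n) => [lt_ijn|lt_nij|ijn] /=; [|lia|ring].
have -> : (n - j == 0)%N = false by lia.
have -> : (n - j + (n - i) == n)%N = false by lia.
by rewrite !xn; try lia; ring.
Qed.

Lemma pair_square_ge0 x p : 0 <= pair_square x p.
Proof.
rewrite /pair_square; case: ifP => _; first exact: sqr_ge0.
case: ifP => _; first exact: sqr_ge0.
by case: ifP => _; rewrite ?sqr_ge0 ?ler01.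
Qed.

(** The sign of [s] is that of its Vandermonde product [V s], so by
    [prod_block_form] all nonzero terms have the same sign. *)
Lemma sum_perm_block_form_neq0 :
  \sum_(s : 'S_n) (-1) ^+ s *
     \prod_(p <- pairs n) block_form (fun j => (perm_val s j)%:R) p
  != 0 :> R.
Proof.
pose x (s : 'S_n) j : R := (perm_val s j)%:R.
pose V s := \prod_(p <- pairs n) (x s p.2 - x s p.1).
have xE s (i : 'I_n) : x s i = (s i)%:R by rewrite /x perm_valE.
have x1E j : (j < n)%N -> x 1%g j = j%:R.
  by move=> jn; rewrite -[j]/(val (Ordinal jn)) xE perm1.
have VE s : V s = (-1) ^+ s * V 1%g.
  pose a s' : 'rV[R]_n := \row_i x s' i.
  have Vdet s' : V s' = \det (Vandermonde n (a s')).
    rewrite det_Vandermonde /V (prod_pairs n (fun i j => x s' j - x s' i)).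
    by apply: eq_bigr => i _; apply: eq_bigr => j _; rewrite !mxE.
  rewrite !Vdet; have -> : Vandermonde n (a s) = col_perm s (Vandermonde n (a 1%g)).
    by apply/matrixP=> i j; rewrite !mxE !xE perm1.
  by rewrite col_permE det_mulmx det_perm odd_permV mulrC.
have V1_neq0 : V 1%g != 0.
  rewrite prodf_seq_neq0; apply/allP => -[i j]; rewrite mem_pairs /= => /andP[ij jn].
  by rewrite !x1E ?(ltn_trans ij) // subr_eq0 eqr_nat; lia.
pose O s := \prod_(p <- pairs n) block_form (x s) p.
pose C := \prod_(p <- pairs n) pair_sign p.
have C_neq0 : C != 0.
  rewrite prodf_seq_neq0; apply/allP => p _ /=.
  by rewrite /pair_sign; case: ifP; rewrite ?oppr_eq0 oner_eq0.
pose Q s := if O s == 0 then 0 else \prod_(p <- pairs n) pair_square (x s) p.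
have VO s : V s * O s = C * Q s.
  rewrite /Q; have [-> | O_neq0] := eqVneq; first by rewrite !mulr0.
  move: O_neq0; rewrite -!big_split prodf_seq_neq0 => /allP O_neq0.
  have [||||| sg0 sgn] := @mirror_of_nonzero n (perm_val s).
  - by move=> j jn; rewrite -[j]/(val (Ordinal jn)) perm_valE.
  - move=> i j lt_in lt_jn.
    rewrite -[i]/(val (Ordinal lt_in)) -[j]/(val (Ordinal lt_jn)) !perm_valE.
    by move/val_inj/perm_inj->.
  - move=> m mn; exists (s^-1 (Ordinal mn))%g; rewrite ?ltn_ord //.
    by rewrite perm_valE permKV.
  - move=> j /andP[j_gt0 jn]; have := O_neq0 (0%N, j).
    by rewrite mem_pairs j_gt0 jn /block_form /= pnatr_eq0; apply.
  - move=> i j /andP[i_gt0 ij] jn ijn; have := O_neq0 (i, j).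
    rewrite mem_pairs ij jn /block_form /= (negPf ijn) (gtn_eqF i_gt0) => /(_ isT).
    by rewrite -natrD subr_eq0 eqr_nat.
  have [n0 | n_gt0] := posnP n.
    have -> : pairs n = [::] by rewrite /pairs n0.
    by rewrite !big_nil.
  apply: prod_block_form => [|i i_n]; first by rewrite /x sg0.
  rewrite /x sgn // natrB //.
  have lt_in : (i < n)%N by case/andP: i_n.
  by rewrite -[i]/(val (Ordinal lt_in)) perm_valE ltnW.
have O1_neq0 : O 1%g != 0.
  rewrite prodf_seq_neq0; apply/allP => -[i j]; rewrite mem_pairs /= => /andP[ij jn].
  rewrite /block_form /= !x1E ?(ltn_trans ij) //; case: (eqVneq i 0%N) => [i0 | _].
    by rewrite pnatr_eq0; lia.
  by case: (eqVneq (i + j)%N n) => ijn; rewrite -?natrD subr_eq0 eqr_nat; lia.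
have Q_ge0 s : 0 <= Q s.
  by rewrite /Q; case: eqP => // _; apply: prodr_ge0 => p _; apply: pair_square_ge0.
have Q1_neq0 : Q 1%g != 0.
  by have := mulf_neq0 V1_neq0 O1_neq0; rewrite VO mulf_eq0 negb_or => /andP[].
apply/negP => /eqP sum0.
have : C * \sum_s Q s = V 1%g * \sum_(s : 'S_n) (-1) ^+ s * O s.
  rewrite !mulr_sumr; apply: eq_bigr => s _.
  by rewrite -VO VE mulrA [V 1%g * _]mulrC.
rewrite sum0 mulr0 => /eqP; rewrite mulf_eq0 (negPf C_neq0) /=.
rewrite psumr_eq0 // => /allP /(_ 1%g).
by rewrite mem_index_enum (negPf Q1_neq0) => /(_ isT).
Qed.
End Block.

Section BlockPermanent.
Variables (R : realDomainType) (W : lmodType R) (B : W -> W -> R).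
Hypothesis BC : forall d l, B d l = B l d.
Hypothesis BDl : forall d d' l, B (d + d') l = B d l + B d' l.
Variables (n : nat) (e : nat -> W).
Hypothesis Be : forall i j, (i < n)%N -> (j < n)%N -> B (e i) (e j) = (i == j)%:R.

Definition block_row (p : nat * nat) : W := e p.2 - e p.1.

(** No column involves [e 0]: the elements with incidence vectors [e 0 + e i] and
    [e 0 + e j] only enter through their difference. *)
Definition block_col (p : nat * nat) : W :=
  if p.1 == 0%N then e p.2
  else if (p.1 + p.2 == n)%N then e p.1 - e p.2 else e p.1 + e p.2.

(** The roles of rows and columns are exchanged with respect to the
    Nullstellensatz: here the differences are taken along the rows, and the
    columns are the linear forms. *)
Lemma per_block_neq0 : per B (map block_col (pairs n)) (map block_row (pairs n)) != 0.
Proof.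
have BDr d l l' : B d (l + l') = B d l + B d l' by rewrite !(BC d) BDl.
have BNr d l : B d (- l) = - B d l.
  by rewrite !(BC d) -sub0r BBl // B0l // sub0r.
rewrite per_sym ?size_map //.
pose off (p : nat * nat) : R := if (p.1 == 0%N) || (p.1 + p.2 == n)%N then 0 else - n%:R.
have -> : map block_row (pairs n) = [seq s.1 - s.2 | s <- [seq (e p.2, e p.1) | p <- pairs n]].
  by rewrite -map_comp.
have -> : map block_col (pairs n) = [seq f.1 | f <- [seq (block_col p, off p) | p <- pairs n]].
  by rewrite -map_comp.
rewrite -iter_diff_prod ?size_map // iter_diff_Vandermonde.
suff -> : \sum_(s : 'S_n) (-1) ^+ s * \prod_(f <- [seq (block_col p, off p) | p <- pairs n])
      (f.2 + B (\sum_(i < n) e i *+ s i) f.1)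
   = \sum_(s : 'S_n) (-1) ^+ s *
     \prod_(p <- pairs n) block_form n (fun j => (perm_val s j)%:R) p.
  exact: sum_perm_block_form_neq0.
apply: eq_bigr => s _; congr (_ * _); rewrite big_map; apply: eq_big_seq => -[i j].
have B0 l : B 0 l = 0 by apply: B0l.
have BS k : (k < n)%N ->
    B (\sum_(i < n) e i *+ s i) (e k) = (perm_val s k)%:R.
  move=> kn; rewrite (big_morph (fun d => B d (e k)) (fun d d' => BDl d d' _) (B0 _)).
  have BM d m l : B (d *+ m) l = B d l *+ m.
    by elim: m => [|m IHm]; rewrite ?mulr0n ?B0 // !mulrS BDl IHm.
  rewrite (bigD1 (Ordinal kn)) //= BM Be // eqxx /perm_val insubT /= big1 ?addr0 // => l.
  by rewrite -val_eqE BM Be //= => /negPf ->; rewrite mul0rn.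
rewrite mem_pairs => /andP[ij jn]; have lt_in := ltn_trans ij jn.
rewrite /off /block_col /block_form /=; case: eqP => _ /=; first by rewrite BS // add0r.
case: eqP => _; first by rewrite BDr BNr !BS // add0r.
by rewrite BDr !BS // addrC.
Qed.
End BlockPermanent.

(** * Weightings of a graph made of cliques *)

Lemma uniq_flatten_map (T U : eqType) (F : T -> seq U) (own : U -> T) s :
    uniq s -> {in s, forall p, uniq (F p)} ->
    {in s, forall p, {in F p, forall c, own c = p}} ->
  uniq (flatten (map F s)).
Proof.
elim: s => //= p s IHs /andP[pNs uniq_s] uniqF ownF.
rewrite cat_uniq uniqF ?mem_head //= IHs //; first last.
- by move=> q qs; apply: ownF; rewrite inE qs orbT.
- by move=> q qs; apply: uniqF; rewrite inE qs orbT.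
rewrite andbT; apply/hasPn => c /flattenP[_ /mapP[q qs ->] cq].
apply: contra pNs => cp; rewrite -(ownF p _ c) ?mem_head //.
by rewrite (ownF q) // inE qs orbT.
Qed.

(** The column of the pair [p], in terms of pairs of positions: [(j, j)] stands
    for the member at position [j], and [(i, j)] with [i < j] for the edge between
    two members. *)
Definition position_spec n (p : nat * nat) : (nat * nat) * option (nat * nat) :=
  if p.1 == 0%N then ((p.2, p.2), None)
  else if (p.1 + p.2 == n)%N then ((0%N, p.1), Some (0%N, p.2)) else (p, None).

Lemma position_specP n p c : p \in pairs n -> c \in spec_vars (position_spec n p) ->
  (c.1 <= c.2)%N && (0 < c.2 < n)%N.
Proof.
case: p => i j; rewrite mem_pairs /position_spec /= => ij.
have [i0 | i_gt0] := posnP i; first by rewrite /= !inE => /eqP-> /=; lia.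
case: eqP => _; rewrite !inE; last by move/eqP-> => /=; lia.
by case/orP=> /eqP-> /=; lia.
Qed.

Lemma uniq_position_specs n : uniq (flatten [seq spec_vars (position_spec n p) | p <- pairs n]).
Proof.
(* The pair in whose column the pair of positions [c] occurs. *)
pose own (c : nat * nat) :=
  if c.1 == c.2 then (0%N, c.2)
  else if c.1 == 0%N then (minn c.2 (n - c.2), maxn c.2 (n - c.2))%N else c.
apply: (@uniq_flatten_map _ _ _ own) (uniq_pairs n) _ _ => -[i j].
  rewrite mem_pairs /position_spec /= => ij; case: eqP => _ //.
  by case: eqP => _ //=; rewrite inE andbT xpair_eqE; lia.
rewrite mem_pairs /position_spec /own /= => ij c.
have [i0 | i_gt0] := posnP i; first by rewrite /= inE => /eqP-> /=; rewrite eqxx i0.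
case: eqP => [ijn | _]; rewrite !inE.
  case/orP=> /eqP-> /=.
    by rewrite ifN ?ifT //; [congr (_, _); lia | lia].
  by rewrite ifN ?ifT //; [congr (_, _); lia | lia].
by move/eqP-> => /=; rewrite !ifN //; lia.
Qed.

Section Graph.
Variables (R : realType) (G : sgraph).
Implicit Types (u v : G) (b : seq G).

Definition incident (z : G + edge G) (v : G) : bool :=
  match z with inl u => v == u | inr A => v \in val A end.

Definition dot (t l : {ffun G -> R^o}) : R := \sum_v t v * l v.
Definition unit_vec v : {ffun G -> R^o} := [ffun w => (w == v)%:R].
Definition dir (z : G + edge G) : {ffun G -> R^o} := [ffun w => (incident z w)%:R].

Lemma dotC t l : dot t l = dot l t.
Proof. by apply: eq_bigr => v _; rewrite mulrC. Qed.

Lemma dotDl t t' l : dot (t + t') l = dot t l + dot t' l.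
Proof. by rewrite -big_split; apply: eq_bigr => v _; rewrite ffunE mulrDl. Qed.

Lemma dotZl c t l : dot (c *: t) l = c * dot t l.
Proof. by rewrite mulr_sumr; apply: eq_bigr => v _; rewrite ffunE mulrA. Qed.

Lemma dot_unit t v : dot t (unit_vec v) = t v.
Proof.
rewrite /dot (bigD1 v) //= ffunE eqxx mulr1 big1 ?addr0 // => w /negPf wv.
by rewrite ffunE wv mulr0.
Qed.

Lemma dotBr t l l' : dot t (l - l') = dot t l - dot t l'.
Proof. by rewrite dotC -scaleN1r dotDl dotZl mulN1r !(dotC _ t). Qed.

Lemma vertex_sumE (f : G + edge G -> R) v :
  vertex_sum f v = (\sum_z f z *: dir z) v.
Proof.
have scaleE (c : R) (x : R^o) : c *: x = c * x by [].
rewrite sum_ffunE big_sumType /= /vertex_sum; congr (_ + _).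
  rewrite (bigD1 v) //= !ffunE /= eqxx scaleE mulr1 big1 ?addr0 // => u /negPf uv.
  by rewrite !ffunE /= eq_sym uv scaleE mulr0.
rewrite big_mkcond; apply: eq_bigr => A _; rewrite !ffunE /= scaleE.
by case: (v \in val A); rewrite ?mulr1 ?mulr0.
Qed.

Lemma edgeP u v : adj u v -> exists A : edge G, val A = [set u; v].
Proof.
move=> uv; have Auv : [set u; v] \in edge_set G by apply/imsetP; exists (u, v); rewrite ?inE.
by exists (Sub [set u; v] Auv).
Qed.

(** The edge joining [u] and [v] if they are adjacent; for [u = v] it is the
    vertex [u], as a singleton is not an edge. *)
Definition element u v : G + edge G :=
  if [pick A : edge G | val A == [set u; v]] is Some A then inr A else inl u.

Lemma incident_element u v w : (u != v) ==> adj u v ->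
  incident (element u v) w = (w == u) || (w == v).
Proof.
rewrite /element; case: pickP => [A /eqP Auv _ | noA]; first by rewrite /= Auv !inE.
have [-> _ | _ /edgeP[A Auv]] := eqVneq u v; first by rewrite /= orbb.
by have := noA A; rewrite Auv eqxx.
Qed.

Section BlockData.
Variables (x0 : G) (b : seq G).
Let n := size b.
Let at_ := nth x0 b.
Hypothesis uniq_b : uniq b.
Hypothesis clique_b : {in b &, forall u v, u != v -> adj u v}.

Definition block_element (c : nat * nat) := element (nth x0 b c.1) (nth x0 b c.2).

Lemma incident_block_element c w : (c.1 < n)%N -> (c.2 < n)%N ->
  incident (block_element c) w = (w == at_ c.1) || (w == at_ c.2).
Proof.
move=> c1n c2n; apply: incident_element; apply/implyP => neq.
by apply: clique_b; rewrite ?mem_nth.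
Qed.

Lemma dir_block_element c : (c.1 < n)%N -> (c.2 < n)%N -> c.1 != c.2 ->
  dir (block_element c) = unit_vec (at_ c.1) + unit_vec (at_ c.2).
Proof.
move=> c1n c2n neq; apply/ffunP => w; rewrite !ffunE incident_block_element //.
case: eqP => [-> | _]; last by rewrite add0r.
by rewrite nth_uniq // (negPf neq) addr0.
Qed.

Definition block_rows := map (block_row (unit_vec \o at_)) (pairs n).

Definition block_specs : seq ((G + edge G) * option (G + edge G)) :=
  [seq (block_element (position_spec n p).1, omap block_element (position_spec n p).2) | p <- pairs n].

Lemma block_spec_vec :
  map (spec_vec dir) block_specs = map (block_col n (unit_vec \o at_)) (pairs n).
Proof.
rewrite -map_comp; apply/eq_in_map => -[i j]; rewrite mem_pairs => /andP[ij jn].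
have lt_in := ltn_trans ij jn; rewrite /position_spec /block_col /spec_vec /=.
case: (eqVneq i 0%N) => [i0 | i_neq0] /=.
  by apply/ffunP=> w; rewrite !ffunE incident_block_element //= orbb.
case: eqP => _ /=; last by rewrite dir_block_element //= neq_ltn ij.
rewrite !dir_block_element //=; try lia.
by rewrite opprD addrACA subrr add0r.
Qed.

Lemma block_vars : flatten (map (@spec_vars _) block_specs)
  = map block_element (flatten [seq spec_vars (position_spec n p) | p <- pairs n]).
Proof.
rewrite map_flatten -!map_comp; congr flatten; apply: eq_map => p /=.
by rewrite /spec_vars /=; case: (position_spec n p) => c [c'|].
Qed.

Lemma block_varsP z : z \in flatten (map (@spec_vars _) block_specs) ->
  (forall v, incident z v -> v \in b)
  /\ exists2 k, (0 < k < n)%N & incident z (at_ k).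
Proof.
rewrite block_vars => /mapP[c /flattenP[_ /mapP[p pn ->] cp] ->].
have /andP[c12 /andP[c2_gt0 c2n]] := position_specP pn cp.
have c1n := leq_ltn_trans c12 c2n; split=> [v|].
  by rewrite incident_block_element // => /orP[] /eqP->; apply: mem_nth.
by exists c.2; rewrite ?c2_gt0 // incident_block_element // eqxx orbT.
Qed.

Lemma uniq_block_vars : uniq (flatten (map (@spec_vars _) block_specs)).
Proof.
rewrite block_vars map_inj_in_uniq ?uniq_position_specs //.
have codeP c : c \in flatten [seq spec_vars (position_spec n p) | p <- pairs n] ->
    (c.1 <= c.2)%N && (0 < c.2 < n)%N.
  by move=> /flattenP[_ /mapP[p pn ->]]; apply: position_specP.
move=> c d /codeP/andP[c12 /andP[_ c2n]] /codeP/andP[d12 /andP[_ d2n]] eq_cd.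
have c1n := leq_ltn_trans c12 c2n; have d1n := leq_ltn_trans d12 d2n.
have mem_cd k : (k < n)%N -> (k == c.1) || (k == c.2) = (k == d.1) || (k == d.2).
  move=> kn; have := incident_block_element (at_ k) c1n c2n.
  by rewrite eq_cd incident_block_element // !nth_uniq.
case: c d {eq_cd} => [i j] [k l] /= in c12 c2n c1n d12 d2n d1n mem_cd *.
have := mem_cd i c1n; have := mem_cd j c2n.
have := mem_cd k d1n; have := mem_cd l d2n.
rewrite !eqxx /= ?orbT => m1 m2 m3 m4.
by congr (_, _); lia.
Qed.

Lemma per_block_rows : per dot (map (spec_vec dir) block_specs) block_rows != 0.
Proof.
rewrite block_spec_vec; apply: per_block_neq0; [exact: dotC | exact: dotDl |].
by move=> i j lt_in lt_jn; rewrite /= dot_unit ffunE nth_uniq // eq_sym.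
Qed.

Lemma block_col_out p u : p \in pairs n ->
  (forall k, (0 < k < n)%N -> at_ k != u) -> block_col n (unit_vec \o at_) p u = 0.
Proof.
case: p => i j; rewrite mem_pairs /block_col /= => ij out.
have at0 k : (0 < k < n)%N -> unit_vec (at_ k) u = 0.
  by move=> kn; rewrite ffunE eq_sym (negPf (out k kn)).
case: (posnP i) => [i0 | i_gt0] /=; first by rewrite at0 //; lia.
have ati : unit_vec (at_ i) u = 0 by apply: at0; lia.
have atj : unit_vec (at_ j) u = 0 by apply: at0; lia.
have natj : (- unit_vec (at_ j)) u = 0 by rewrite [LHS]ffunE atj oppr0.
by case: eqP => _; rewrite [LHS]ffunE /= ati ?atj ?natj addr0.
Qed.
End BlockData.

(** What makes the matrix block triangular: a clique meets the later ones at most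
    in its head, which its columns do not involve. *)
Fixpoint block_order (x0 : G) (bs : seq (seq G)) : Prop :=
  if bs is b :: bs' then
    [/\ uniq b, {in b &, forall u v, u != v -> adj u v},
        {in bs', forall b', {in b, forall v, v \in b' -> v = nth x0 b 0}}
      & block_order x0 bs']
  else True.

Definition all_rows x0 bs := flatten (map (block_rows x0) bs).
Definition all_specs x0 bs := flatten (map (block_specs x0) bs).

(** The columns of a clique live on its members other than the head, hence vanish
    on the rows of later cliques; and each of its elements is incident with such
    a member, hence is different from the elements used later. *)
Lemma block_order_per x0 bs : block_order x0 bs ->
  [/\ size (all_specs x0 bs) = size (all_rows x0 bs),
      uniq (flatten (map (@spec_vars _) (all_specs x0 bs)))
    & per dot (map (spec_vec dir) (all_specs x0 bs)) (all_rows x0 bs) != 0].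
Proof.
elim: bs => [_ | b bs IHbs /= [uniq_b clique_b sep_b bsP]].
  by split=> //=; rewrite oner_eq0.
have [sz uniq_bs per_bs] := IHbs bsP.
have tail_in z : z \in flatten (map (@spec_vars _) (all_specs x0 bs)) ->
    exists2 b', b' \in bs & forall v, incident z v -> v \in b'.
  elim: bs bsP {IHbs sep_b sz uniq_bs per_bs} => [|b' bs IHbs] //=.
  case=> uniq_b' clique_b' _ bsP.
  rewrite /all_specs /= map_cat flatten_cat mem_cat => /orP[/block_varsP[]// zb' _|].
    by exists b'; rewrite ?mem_head.
  by case/IHbs=> // b2 b2bs zb2; exists b2; rewrite // inE b2bs orbT.
have szb : size (block_specs x0 b) = size (block_rows x0 b) by rewrite !size_map.
rewrite /all_specs /all_rows /= -/(all_specs x0 bs) -/(all_rows x0 bs).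
split.
- by rewrite !size_cat szb sz.
- rewrite map_cat flatten_cat cat_uniq uniq_block_vars // uniq_bs andbT /=.
  apply/hasPn => z /tail_in[b' b'bs zb']; apply/negP => /block_varsP[] // _ [k /andP[k_gt0 kn] zk].
  have /eqP := sep_b _ b'bs _ (mem_nth x0 kn) (zb' _ zk).
  by rewrite nth_uniq ?(ltn_trans k_gt0) // (gtn_eqF k_gt0).
rewrite map_cat per_cat ?mulf_neq0 ?per_block_rows // ?size_map //.
move=> d l; rewrite block_spec_vec // => /mapP[p pn ->].
case/flattenP=> _ /mapP[b' b'bs ->] /mapP[[i j]].
rewrite mem_pairs => /andP[ij jb'] ->; rewrite dotBr !dot_unit /=.
have out k : (k < size b')%N -> block_col (size b) (unit_vec \o nth x0 b) p (nth x0 b' k) = 0.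
  move=> kb'; apply: block_col_out => // m /andP[m_gt0 mn]; apply/eqP => eq_mk.
  have mb' : nth x0 b m \in b' by rewrite eq_mk mem_nth.
  have /eqP := sep_b _ b'bs _ (mem_nth x0 mn) mb'.
  by rewrite nth_uniq ?(ltn_trans m_gt0) // (gtn_eqF m_gt0).
by rewrite !out ?subrr // (ltn_trans ij).
Qed.

Lemma choosable_of_blocks x0 bs : block_order x0 bs ->
  (forall u v : G, adj u v -> exists2 b, b \in bs & (u \in b) && (v \in b)) ->
  choosable R 2 2 G.
Proof.
move=> bsP cover L L2v L2e.
have L2 z : #|` L z| = 2 by case: z.
have [[sz uniq_vars] /per_specs[]] := block_order_per bsP; first exact: dotDl.
move=> zs [szs sub_zs per_zs].
have /fin_all_exists[w w_ok] : forall z, exists w : R * R,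
    [/\ w.1 \in L z, w.2 \in L z & w.1 != w.2].
  move=> z; have := fset_uniq (L z); move: (L2 z).
  case Lz: (enum_fset (L z)) => [|x [|y []]] //= _; rewrite inE andbT => xy.
  have memL t : (t \in L z) = (t \in [:: x; y]) by rewrite -Lz.
  by exists (x, y); rewrite !memL !inE !eqxx orbT.
have [||||f f_ok f_rows] := @nullstellensatz R {ffun G -> R^o} dot dotDl dotZl _ dir
    (fun z => (w z).1) (fun z => (w z).2) zs (all_rows x0 bs).
- by move=> z; case: (w_ok z).
- exact: subseq_uniq sub_zs uniq_vars.
- by rewrite szs.
- exact: per_zs.
exists f; split=> [u v uv | z]; last first.
  by case: (w_ok z) => w1 w2 _; case: (f_ok z) => ->.
have [b bbs /andP[ub vb]] := cover u v uv.
have diff i j : (i < j < size b)%N ->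
    vertex_sum f (nth x0 b i) != vertex_sum f (nth x0 b j).
  move=> ij; have := f_rows (block_row (unit_vec \o nth x0 b) (i, j)).
  rewrite dotBr !dot_unit -!vertex_sumE subr_eq0 /= eq_sym; apply.
  apply/flattenP; exists (block_rows x0 b); first exact: map_f.
  by apply: map_f; rewrite mem_pairs.
apply/eqP; have ub' := ub; have vb' := vb; rewrite -index_mem in ub'; rewrite -index_mem in vb'.
have [lt_uv | lt_vu | eq_uv] := ltngtP (index u b) (index v b).
- by have := diff _ _ (introT andP (conj lt_uv vb')); rewrite !nth_index.
- by have := diff _ _ (introT andP (conj lt_vu ub')); rewrite !nth_index // eq_sym.
by move: uv; rewrite -(nth_index x0 ub) eq_uv nth_index // adj_irrefl.
Qed.
End Graph.

(** * Forests *)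

(** Otherwise every vertex of [S] has two neighbours in [S], and a simple path in
    [S] can always be extended at its first vertex [x]: a neighbour of [x] other
    than its successor cannot lie on the path without closing a cycle. But the
    length of simple paths is bounded. *)
Lemma acyclic_low_degree (T : sgraph) (S : {set T}) : acyclic_graph T -> S != set0 ->
  exists2 p, p \in S & {in S &, forall q q', adj p q -> adj p q' -> q = q'}.
Proof.
move=> acycT /set0Pn[x0 x0S].
have [/exists_inP[p pS /forall_inP pP] | /exists_inPn noP] := boolP
    [exists p in S, [forall q in S, [forall q' in S, adj p q ==> adj p q' ==> (q == q')]]].
  exists p => // q q' qS q'S pq pq'.
  by have /forall_inP/(_ q' q'S) := pP q qS; rewrite pq pq' => /eqP.
have branch x y : x \in S -> exists c, [/\ c \in S, adj x c & c != y].
  move=> /noP /forall_inPn[q qS /forall_inPn[q' q'S]].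
  rewrite !negb_imply => /and3P[xq xq' qq'].
  have [qy | ] := eqVneq q y; last by exists q.
  by exists q'; split; rewrite // eq_sym -qy.
have long k : exists x p, [/\ size p = k, path (@adj T) x p, uniq (x :: p)
                            & {subset x :: p <= S}].
  elim: k => [|k [x [p [szp xp uniq_xp pS]]]].
    by exists x0, [::]; split=> // y; rewrite inE => /eqP->.
  have [c [cS xc cNhead]] := branch x (head x p) (pS x (mem_head _ _)).
  have [cp | cNp] := boolP (c \in x :: p); last first.
    exists c, (x :: p); split.
    - by rewrite /= szp.
    - by rewrite /= adj_sym xc.
    - by rewrite cons_uniq cNp.
    by move=> y; rewrite inE => /predU1P[-> // | /pS].
  have {}cp : c \in p.
    by move: cp; rewrite inE => /predU1P[cx|//]; rewrite cx adj_irrefl in xc.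
  case: p => [|y p] // in xp uniq_xp cNhead cp {szp pS} *.
  rewrite /= in cNhead; move: cp; rewrite inE (negPf cNhead) /= => cp.
  case/splitPr: cp => p1 p2 in xp uniq_xp.
  case: (@acycT (x :: y :: rcons p1 c)); first by rewrite /= size_rcons.
  apply/andP; split.
    move: xp; rewrite -cat_rcons /= cat_path => /and3P[xy yc _].
    by rewrite xy rcons_path yc last_rcons adj_sym xc.
  move: uniq_xp; rewrite -cat_rcons -!cat_cons cat_uniq.
  by case/andP.
have [x [p [szp _ uniq_xp _]]] := long #|T|.
by have := max_card (mem (x :: p)); rewrite (card_uniqP uniq_xp) /= szp ltnn.
Qed.

Fixpoint elimination (T : sgraph) (vs : seq T) : Prop :=
  if vs is p :: s then
    [/\ p \notin s, {in s &, forall q q', adj p q -> adj p q' -> q = q'}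
      & elimination s]
  else True.

Lemma acyclic_elimination (T : sgraph) : acyclic_graph T ->
  exists2 vs : seq T, elimination vs & forall v, v \in vs.
Proof.
move=> acycT; suff [vs vsE vsS] : exists2 vs, elimination vs & vs =i [set: T].
  by exists vs => // v; rewrite vsS inE.
move: [set: T] => S; elim: {S}#|S| {-2}S (erefl #|S|) => [|k IHk] S cardS.
  by exists [::] => // v; rewrite (cards0_eq cardS) !inE.
have [|p pS low] := acyclic_low_degree acycT (S := S).
  by rewrite -card_gt0 cardS.
have [|vs vsE vsS] := IHk (S :\ p); first by rewrite (cardsD1 p) pS in cardS; case: cardS.
exists (p :: vs) => [|v]; last by rewrite inE vsS !inE; case: eqP => // ->.
split=> //; first by rewrite vsS !inE eqxx.
by move=> q q'; rewrite !vsS => /setD1P[_ qS] /setD1P[_ q'S]; apply: low.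
Qed.

(** * Graphs decomposed along a forest *)

Section Cells.
Variables (R : realType) (T G : sgraph) (m : T -> pred G).
Hypothesis acycT : acyclic_graph T.
Hypothesis m_clique : forall p z w, m p z -> m p w -> z != w -> adj z w.
Hypothesis m_cover : forall z w, adj z w -> exists p, m p z && m p w.
Hypothesis m_adj : forall p q z, p != q -> m p z -> m q z -> adj p q.
Hypothesis m_inj : forall p q z z', p != q ->
  m p z -> m q z -> m p z' -> m q z' -> z = z'.

(** The members of the cell of [p], those shared with a cell of [s] first. When
    [s] consists of the vertices removed after [p], there is at most one of them,
    and it becomes the head of the clique. *)
Definition cell (p : T) (s : seq T) : seq G :=
  [seq z <- enum (m p) | has (m^~ z) s] ++ [seq z <- enum (m p) | ~~ has (m^~ z) s].

Lemma perm_cell p s : perm_eql (cell p s) (enum (m p)).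
Proof. exact/permPl/permEl/perm_filterC. Qed.

Lemma mem_cell p s z : (z \in cell p s) = m p z.
Proof. by rewrite (perm_mem (permEl (perm_cell p s))) mem_enum. Qed.

Lemma uniq_cell p s : uniq (cell p s).
Proof. by rewrite (perm_uniq (permEl (perm_cell p s))) enum_uniq. Qed.

Fixpoint cells (vs : seq T) : seq (seq G) :=
  if vs is p :: s then cell p s :: cells s else [::].

Lemma mem_cells vs b : b \in cells vs -> exists2 q, q \in vs & b =i m q.
Proof.
elim: vs => //= p s IHs; rewrite inE => /predU1P[-> | /IHs[q qs bq]].
  by exists p; [exact: mem_head | exact: mem_cell].
by exists q; rewrite // inE qs orbT.
Qed.

Lemma cells_cover vs p : p \in vs -> exists2 b, b \in cells vs & b =i m p.
Proof.
elim: vs => //= q s IHs; rewrite inE => /predU1P[-> | /IHs[b bs bp]].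
  by exists (cell q s); [exact: mem_head | exact: mem_cell].
by exists b; rewrite // inE bs orbT.
Qed.

Lemma cells_order x0 vs : elimination vs -> block_order x0 (cells vs).
Proof.
elim: vs => //= p s IHs [pNs low /IHs order_s]; split=> //.
- exact: uniq_cell.
- by move=> u v; rewrite !mem_cell; apply: m_clique.
move=> b /mem_cells[q qs bq] z; rewrite mem_cell bq => pz qz.
have pNeq r : r \in s -> p != r by move=> rs; apply: contraNneq pNs => ->.
have : z \in [seq z <- enum (m p) | has (m^~ z) s].
  by rewrite mem_filter mem_enum andbC [_ \in _]pz; apply/hasP; exists q.
rewrite /cell; case E: [seq _ <- _ | _] => [|z' l] // _ /=.
have: z' \in [seq z <- enum (m p) | has (m^~ z) s] by rewrite E mem_head.
rewrite mem_filter mem_enum => /andP[/hasP[r rs rz'] pz'].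
have qr : q = r.
  by apply: low; rewrite // ?(m_adj (pNeq q qs) pz qz) ?(m_adj (pNeq r rs) pz' rz').
by apply: (@m_inj p q) => //; [exact: pNeq | rewrite qr].
Qed.

(** The order in which the forest is dismantled makes the cells a sequence of
    cliques as required by [choosable_of_blocks]. *)
Lemma choosable_of_cells : choosable R 2 2 G.
Proof.
have [vs vsE mem_vs] := acyclic_elimination acycT.
case: (pickP G) => [x0 _ | noG].
  apply: choosable_of_blocks (cells_order x0 vsE) _ => u v /m_cover[p /andP[pu pv]].
  by have [b bs bp] := cells_cover (mem_vs p); exists b; rewrite ?bp //; apply/andP.
move=> L L2v L2e; exists (fun z => head 0 (enum_fset (L z))).
split=> [u | z]; first by have := noG u.
have : #|` L z| = 2 by case: z.
rewrite -[_ \in _]/(_ \in enum_fset (L z)).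
by case: (enum_fset (L z)) => // x l _; rewrite mem_head.
Qed.
End Cells.

(** * Line graphs and Q-graphs of trees *)

Lemma edge_ends (T : sgraph) (A : edge T) p q : p != q -> p \in val A -> q \in val A ->
  adj p q /\ val A = [set p; q].
Proof.
case: A => A /= /imsetP[[u v]]; rewrite ?inE /= => uv -> pNq; rewrite !inE.
case/orP=> /eqP pE /orP[] /eqP qE; move: pNq; rewrite {}pE {}qE ?eqxx // => _.
by rewrite adj_sym setUC.
Qed.

Theorem corollary4p2 (R : realType) (T : sgraph) (hT : tree T) :
  choosable R 2 2 (line_graph T) /\ choosable R 2 2 (q_graph T).
Proof.
have [_ acycT] := hT.
have ends (A : edge T) p q : p != q -> p \in val A -> q \in val A ->
    adj p q /\ val A = [set p; q].
  exact: edge_ends.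
split.
  apply: (@choosable_of_cells R T (line_graph T)
    (fun p (A : edge T) => p \in val A)) => //.
  - move=> p A B pA pB AB; rewrite /= /line_adj AB; apply/set0Pn; exists p.
    by rewrite inE pA.
  - by move=> A B /andP[_ /set0Pn[p]]; rewrite inE; exists p.
  - by move=> p q A pq pA qA; have [] := ends A p q pq pA qA.
  move=> p q A B pq pA qA pB qB; apply: val_inj.
  by have [_ ->] := ends A p q pq pA qA; have [_ ->] := ends B p q pq pB qB.
(* In Q(T) the cell of [p] also contains [p] itself, which lies in no other
   cell. *)
apply: (@choosable_of_cells R T (q_graph T)
  (fun p (z : T + edge T) => match z with
  | inl v => v == p | inr A => p \in val A end)) => //.
- move=> p [u|A] [v|B] /=.
  + by move/eqP->; move/eqP->; rewrite eqxx.
  + by move/eqP->.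
  + by move=> ? /eqP->.
  move=> pA pB AB; rewrite /line_adj; apply/andP; split=> //.
  by apply/set0Pn; exists p; rewrite inE pA.
- move=> [u|A] [v|B] //=.
  + by move=> uB; exists u; rewrite eqxx.
  + by move=> vA; exists v; rewrite eqxx andbT.
  by move=> /andP[_ /set0Pn[p]]; rewrite inE; exists p.
- move=> p q [u|A] pq /=; first by move/eqP=> -> /eqP pq'; rewrite pq' eqxx in pq.
  by move=> pA qA; have [] := ends A p q pq pA qA.
move=> p q [u|A] [v|B] pq /=; try by move=> /eqP-> /eqP pq'; rewrite pq' eqxx in pq.
  by move=> _ _ /eqP-> /eqP pq'; rewrite pq' eqxx in pq.
move=> pA qA pB qB; congr inr; apply: val_inj.
by have [_ ->] := ends A p q pq pA qA; have [_ ->] := ends B p q pq pB qB.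
Qed.
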